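(* Let $\phi:\mathbb{R}\to\mathbb{R}$ be a real-valued, even Schwartz function, let $t_0\in\mathbb{R}$, and fix $\delta_0>0$. Let $\rho=\beta+i\gamma$ be a zero of $\Xi$ with $\beta>1/2+\delta_0$, paired with $1-\overline\rho=(1-\beta)+i\gamma$, and let $Y\ge|\gamma|$. Suppose that $\widehat\phi\ge0$ and that there is a constant $c_0>0$ with $$\cos((\gamma-t_0)u)\ge c_0\qquad\text{for all }u\in\operatorname{supp}(\widehat\phi)\cap[0,\infty).$$ Then the paired contribution $C_\rho(1/2-\delta_0)+C_{1-\overline\rho}(1/2-\delta_0)$ to $M_Y''(1/2-\delta_0;t_0,\phi)$ satisfies $$C_\rho(1/2-\delta_0)+C_{1-\overline\rho}(1/2-\delta_0)\ \ge\ 2c_0\int_0^\infty u^2e^{-(\beta-1/2)u}\sinh(\delta_0u)\,\widehat\phi(u)\,du\ \ge\ 0 .$$ The paired contribution is strictly positive if $\widehat\phi$ is positive on a set of positive measure.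
   Context: $\Xi(s)=\tfrac12 s(s-1)\pi^{-s/2}\Gamma(s/2)\zeta(s)$ is the completed Riemann zeta function, an entire function whose zero set is symmetric under $\rho\mapsto1-\overline\rho$. The Fourier transform is $\widehat\phi(u)=\int_{\mathbb{R}}\phi(t)e^{-iut}\,dt$ (real and even for $\phi$ real and even). For $Y>0$ let $\mathcal{Z}_Y=\{\rho=\beta+i\gamma:\Xi(\rho)=0,\ |\gamma|\le Y\}$, with multiplicities, $R_Y(s)=\sum_{\rho\in\mathcal{Z}_Y}\frac1{s-\rho}$, and $$M_Y(\sigma;t_0,\phi)=\int_{\mathbb{R}}\phi(t-t_0)\operatorname{Re}R_Y(\sigma+it)\,dt ,$$ with $M_Y''$ the second derivative in $\sigma$. The contribution of a single zero $\rho=\beta+i\gamma$ (with $\beta\ne\sigma$) to $M_Y''(\sigma;t_0,\phi)$ is $$C_\rho(\sigma)=\operatorname{Re}\int_{\mathbb{R}}\frac{2\phi(t-t_0)}{(\sigma+it-\rho)^3}\,dt .$$ *)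

(* Defs.v *)
From HB Require Import structures.
From mathcomp Require Import all_boot all_order all_algebra.
From mathcomp Require Import all_classical all_reals all_analysis.
From mathcomp Require Import complex.
Set Implicit Arguments.
Unset Strict Implicit.
Unset Printing Implicit Defensive.
Import Order.TTheory GRing.Theory Num.Theory numFieldNormedType.Exports.
Local Open Scope classical_set_scope.
Local Open Scope ring_scope.
Local Open Scope complex_scope.

Definition sinh (R : realType) (x : R) : R := (expR x - expR (- x)) / 2.

Definition cexp (R : realType) (z : R[i]) : R[i] :=
  (expR (complex.Re z))%:C * (cos (complex.Im z) +i* sin (complex.Im z)).

(* x ^ s with the principal logarithm; meaningful for 0 < x *)
Definition cpow (R : realType) (x : R) (s : R[i]) : R[i] := cexp (s * (ln x)%:C).

Definition cintegral (R : realType) (D : set R) (f : R -> R[i]) : R[i] :=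
  Rintegral lebesgue_measure D (fun x => complex.Re (f x))
  +i* Rintegral lebesgue_measure D (fun x => complex.Im (f x)).

(* Euler's integral; meaningful for 0 < Re s *)
Definition Gamma (R : realType) (s : R[i]) : R[i] :=
  cintegral `]0, +oo[ (fun x => cpow x (s - 1) * (expR (- x))%:C).

(* Dirichlet series; meaningful for 1 < Re s *)
Definition zeta (R : realType) (s : R[i]) : R[i] :=
  limn (series (fun n : nat => cpow n.+1%:R (- s)) : nat -> (R[i])^o).

(* complex differentiability at every point: R[i]^o is R[i] as a normed module
   over itself, so that the difference quotients have complex increments *)
Definition entire (R : realType) (f : R[i] -> R[i]) : Prop :=
  forall z : R[i], derivable (f : (R[i])^o -> (R[i])^o) z 1.

(* Xi is THE entire function given by s(s-1)/2 pi^(-s/2) Gamma(s/2) zeta(s):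
   the formula is imposed on the half-plane Re s > 1, where the integral and the
   series converge, and by the identity theorem determines Xi everywhere. *)
Definition is_completed_zeta (R : realType) (Xi : R[i] -> R[i]) : Prop :=
  entire Xi /\
  forall s : R[i], 1 < complex.Re s ->
    Xi s = s * (s - 1) / 2 * cpow pi (- (s / 2)) * Gamma (s / 2) * zeta s.

(* zeros without their multiplicities, which are irrelevant to membership *)
Definition zeros_upto (R : realType) (Xi : R[i] -> R[i]) (Y : R) : set R[i] :=
  [set rho | Xi rho = 0 /\ `|complex.Im rho| <= Y].

Definition schwartz (R : realType) (phi : R -> R) : Prop :=
  (forall (n : nat) (x : R), derivable (derive1n n phi) x 1) /\
  (forall k n : nat, exists M : R, forall x : R,
     `|x| ^+ k * `|derive1n n phi x| <= M).

(* Complex-valued; for phi real and even the values are real. In the order of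
   R[i], 0 <= z means that z is real and nonnegative. *)
Definition fourier (R : realType) (phi : R -> R) (u : R) : R[i] :=
  cintegral [set: R] (fun t => (phi t)%:C * cexp (0 +i* - (u * t))).

Definition supp (R : realType) (f : R -> R[i]) : set R :=
  closure [set u | f u != 0].

(* 2 / (s - rho)^3 is the second derivative of 1 / (s - rho): this is the term
   due to rho in the second sigma-derivative of the integral over t of
   phi (t - t0) * Re (sum over zeros rho of 1 / (sigma + it - rho)). *)
Definition zero_contribution (R : realType) (phi : R -> R) (t0 : R)
    (rho : R[i]) (sigma : R) : R :=
  complex.Re (cintegral [set: R]
    (fun t => 2 * (phi (t - t0))%:C / (sigma +i* t - rho) ^+ 3)).

(* Main.v *)
(** Writing z = a + iy with a > 0, 2/z^3 is the Laplace transform of u^2, that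
    is, the integral of u^2 e^(-zu) over u >= 0. By Fubini, the contribution of
    a zero at signed horizontal distance a > 0 is therefore the integral over
    u >= 0 of u^2 e^(-au) cos((gamma - t0) u) times the Fourier transform of phi
    at u. Since Re(1/z^3) is odd in a, the two paired zeros, at distances
    beta - 1/2 - delta0 and -(beta - 1/2 + delta0), enter with opposite signs;
    the difference of the two exponentials is
    2 e^(-(beta - 1/2) u) sinh(delta0 u) >= 0, and on the support of the Fourier
    transform the cosine is at least c0. *)
Require Import Defs.
From HB Require Import structures.
From mathcomp Require Import all_boot all_order all_algebra.
From mathcomp Require Import all_classical all_reals all_analysis.
From mathcomp Require Import complex.
From mathcomp Require Import measurable_realfun.
From mathcomp Require Import ring lra.
Import Order.TTheory GRing.Theory Num.Theory numFieldNormedType.Exports.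
Local Open Scope classical_set_scope.
Local Open Scope ring_scope.
Local Open Scope complex_scope.

Section laplace_representation.
Local Notation mu := lebesgue_measure.

(** * The Laplace transform of u^2, in real form *)

Lemma cvgy_polyexp {R : realType} (a : R) (n : nat) : 0 < a ->
  (fun u : R => u ^+ n * expR (- (a * u))) u @[u --> +oo] --> (0 : R).
Proof.
(* One term of the exponential series, e^(au) >= (au)^(n+1) / (n+1)!, gives u^n e^(-au) <= C / u for
   u > 0. *)
move=> a0; pose C : R := n.+1`!%:R / a ^+ n.+1.
have C0 : 0 < C by rewrite divr_gt0 ?exprn_gt0// ltr0n fact_gt0.
have cvgC : (fun u : R => C * u^-1) u @[u --> +oo] --> (0 : R).
  rewrite -[X in _ --> X](mulr0 C); apply: cvgMl_tmp.
  apply/(gtr0_cvgV0 _).2; last exact: cvg_id.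
  exact: nbhs_pinfty_gt.
apply: (@squeeze_cvgr _ _ _ _ (cst 0) (fun u => C * u^-1)) => //;
  last exact: cvg_cst.
near=> u.
have u0 : 0 < u by near: u; exact: nbhs_pinfty_gt.
rewrite mulr_ge0 ?exprn_ge0 ?expR_ge0 ?(ltW u0)//= expRN.
rewrite ler_pdivrMr ?expR_gt0// mulrAC ler_pdivlMr// -exprSr.
have /le_trans : u ^+ n.+1 <= C * ((a * u) ^+ n.+1 / n.+1`!%:R).
  rewrite /C exprMn le_eqVlt; apply/orP; left; apply/eqP; field.
  by rewrite pnatr_eq0 -lt0n fact_gt0 expf_neq0 ?lt0r_neq0.
apply; rewrite ler_pM2l// (le_trans _ (expR_ge1Dxn n _)) ?lerDr//.
by rewrite mulr_ge0 ?ltW.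
Unshelve. all: by end_near. Qed.

(* With z = a + iy this is the real part of
   - e^(-zu) (u^2 / z + 2u / z^2 + 2 / z^3), a primitive of u^2 e^(-zu). *)
Definition laplace_primitive {R : realType} (a y u : R) :=
  - (expR (- (a * u)) *
    (cos (y * u) * (u ^+ 2 * (a / (a ^+ 2 + y ^+ 2))
       + 2 * u * ((a ^+ 2 - y ^+ 2) / (a ^+ 2 + y ^+ 2) ^+ 2)
       + 2 * ((a ^+ 3 - 3 * a * y ^+ 2) / (a ^+ 2 + y ^+ 2) ^+ 3))
    + sin (y * u) * (u ^+ 2 * (- y / (a ^+ 2 + y ^+ 2))
       + 2 * u * ((- 2 * a * y) / (a ^+ 2 + y ^+ 2) ^+ 2)
       + 2 * ((y ^+ 3 - 3 * a ^+ 2 * y) / (a ^+ 2 + y ^+ 2) ^+ 3)))).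

Lemma is_derive_laplace_primitive {R : realType} (a y u : R) : 0 < a ->
  is_derive u 1 (laplace_primitive a y)
    (u ^+ 2 * expR (- (a * u)) * cos (y * u)).
Proof.
move=> a0; have D0 : a ^+ 2 + y ^+ 2 != 0 by nra.
rewrite /laplace_primitive; apply: is_derive_eq.
rewrite /GRing.scale /=.
by field.
Qed.

(** The trigonometric factor is bounded by |c| + |d|, so the decay is that of u^n e^(-au). Each term
    of [laplace_primitive] has this shape. *)
Lemma cvgy_trig_polyexp {R : realType} (a y c d : R) (n : nat) : 0 < a ->
  (fun u : R => (c * cos (y * u) + d * sin (y * u)) *
     (u ^+ n * expR (- (a * u)))) u
    @[u --> +oo] --> (0 : R).
Proof.
move=> a0; apply/norm_cvg0P.
apply: (@squeeze_cvgr _ _ _ _ (cst 0)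
  (fun u => (`|c| + `|d|) * (u ^+ n * expR (- (a * u))))).
- near=> u; have u0 : 0 <= u by near: u; exact: nbhs_pinfty_ge.
  rewrite normr_ge0 /= normrM [X in _ * X]ger0_norm; last first.
    by rewrite mulr_ge0 ?exprn_ge0 ?expR_ge0.
  rewrite ler_wpM2r ?mulr_ge0 ?exprn_ge0 ?expR_ge0//.
  rewrite (le_trans (ler_normD _ _))// !normrM lerD//.
    by rewrite ler_piMr// cos_max.
  by rewrite ler_piMr// sin_max.
- exact: cvg_cst.
- by rewrite -[X in _ --> X](mulr0 (`|c| + `|d|)); apply: cvgMl_tmp;
  exact: cvgy_polyexp.
Unshelve. all: by end_near. Qed.

Lemma cvgy_laplace_primitive {R : realType} (a y : R) :
  0 < a -> laplace_primitive a y u @[u --> +oo] --> (0 : R).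
Proof.
move=> a0; set D := a ^+ 2 + y ^+ 2.
(* Regrouping by the powers u^2, u^1, u^0 leaves three terms, each of which decays. *)
rewrite (_ : laplace_primitive a y = fun u =>
  (- (a / D) * cos (y * u) + - (- y / D) * sin (y * u)) *
    (u ^+ 2 * expR (- (a * u)))
  + ((- (2 * ((a ^+ 2 - y ^+ 2) / D ^+ 2)) * cos (y * u)
     + - (2 * ((-2 * a * y) / D ^+ 2)) * sin (y * u)) *
     (u ^+ 1 * expR (- (a * u)))
  + (- (2 * ((a ^+ 3 - 3 * a * y ^+ 2) / D ^+ 3)) * cos (y * u)
     + - (2 * ((y ^+ 3 - 3 * a ^+ 2 * y) / D ^+ 3)) * sin (y * u)) *
     (u ^+ 0 * expR (- (a * u))))); last first.
  by apply/funext => u; rewrite /laplace_primitive -/D; ring.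
rewrite -[X in _ --> X](addr0 0); apply: cvgD; first exact: cvgy_trig_polyexp.
by rewrite -[X in _ --> X](addr0 0); apply: cvgD; exact: cvgy_trig_polyexp.
Qed.

(* The real part of 2 / (a + iy)^3. *)
Definition laplace_kernel {R : realType} (a y : R) :=
  2 * ((a ^+ 3 - 3 * a * y ^+ 2) / (a ^+ 2 + y ^+ 2) ^+ 3).

Lemma laplace_primitive_at0 {R : realType} (a y : R) :
  laplace_primitive a y 0 = - laplace_kernel a y.
Proof.
rewrite /laplace_primitive /laplace_kernel !mulr0 oppr0 cos0 sin0 expR0 expr0n.
by rewrite /=; ring.
Qed.

Lemma continuous_expR_cos {R : realType} (a y : R) :
  continuous (fun u : R => u ^+ 2 * expR (- (a * u)) * cos (y * u)).
Proof.
move=> u; apply/differentiable_continuous/derivable1_diffP.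
by apply: ex_derive.
Qed.

(** For y = 0 the integrand is nonnegative, so the fundamental theorem on a half-line applies
    directly. The finite value makes u^2 e^(-au) available as a majorant. *)
Lemma integral_sqr_expR {R : realType} (a : R) : 0 < a ->
  (\int[mu]_(u in `[0%R : R, +oo[) (u ^+ 2 * expR (- (a * u)))%:E =
    (laplace_kernel a 0)%:E)%E.
Proof.
move=> a0.
have E u : u ^+ 2 * expR (- (a * u)) = u ^+ 2 * expR (- (a * u)) * cos (0 * u).
  by rewrite mul0r cos0 mulr1.
rewrite (@ge0_continuous_FTC2y _ _ (laplace_primitive a 0) 0 0).
- by rewrite laplace_primitive_at0 -EFinD sub0r opprK.
- by move=> x x0; rewrite mulr_ge0 ?exprn_ge0 ?expR_ge0.
- apply: continuous_subspaceT.
  by under [X in continuous X]eq_fun do rewrite E; exact: continuous_expR_cos.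
- exact: cvgy_laplace_primitive.
- by move=> x _; have [] := is_derive_laplace_primitive a 0 x a0.
- by apply/cvg_at_right_filter/differentiable_continuous/derivable1_diffP;
    have [] := is_derive_laplace_primitive a 0 0 a0.
- by move=> x _; rewrite E derive1E; have [_ ->] :=
  is_derive_laplace_primitive a 0 x a0.
Qed.

Lemma integrable_sqr_expR {R : realType} (a : R) : 0 < a ->
  mu.-integrable `[0%R : R, +oo[ (EFin \o (fun u : R =>
    u ^+ 2 * expR (- (a * u)))).
Proof.
move=> a0; apply/integrableP; split.
  apply/measurable_EFinP; apply: measurable_funTS.
  apply: continuous_measurable_fun => u.
  apply/differentiable_continuous/derivable1_diffP.
  by apply: ex_derive.
have E (u : R) : `|u ^+ 2 * expR (- (a * u))| = u ^+ 2 * expR (- (a * u)).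
  by rewrite ger0_norm// mulr_ge0 ?sqr_ge0 ?expR_ge0.
under eq_integral do rewrite /= E.
by rewrite integral_sqr_expR// ltry.
Qed.

Lemma integrable_expR_cos {R : realType} (a y : R) : 0 < a ->
  mu.-integrable `[0%R : R, +oo[ (EFin \o (fun u : R =>
    u ^+ 2 * expR (- (a * u)) * cos (y * u))).
Proof.
move=> a0; apply: le_integrable (integrable_sqr_expR a a0) => //.
  apply/measurable_EFinP; apply: measurable_funTS.
  by apply: continuous_measurable_fun; exact: continuous_expR_cos.
by move=> u _ /=; rewrite lee_fin normrM ler_piMr// cos_max.
Qed.

Lemma Rintegral_expR_cos {R : realType} (a y : R) : 0 < a ->
  Rintegral mu `[0%R : R, +oo[ (fun u : R =>
    u ^+ 2 * expR (- (a * u)) * cos (y * u)) = laplace_kernel a y.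
Proof.
move=> a0.
(* FTC2y needs a nonnegative integrand: cos (0 * u) = 1 makes it 1 + cos. *)
pose f u : R := u ^+ 2 * expR (- (a * u)) * cos (0 * u) +
                u ^+ 2 * expR (- (a * u)) * cos (y * u).
pose G u := laplace_primitive a 0 u + laplace_primitive a y u.
have df (u : R) : is_derive u 1 G (f u).
  by apply: is_deriveD; exact: is_derive_laplace_primitive.
have cG : continuous G.
  by move=> x; apply/differentiable_continuous/derivable1_diffP;
    have [] := df x.
have H : Rintegral mu `[0%R : R, +oo[ f =
  laplace_kernel a 0 + laplace_kernel a y.
  rewrite (@Rintegral_ge0_continuous_FTC2y _ _ G 0 0).
  - by rewrite /G !laplace_primitive_at0; ring.
  - move=> x x0; rewrite /f -mulrDr mulr_ge0 ?mulr_ge0 ?exprn_ge0 ?expR_ge0//.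
    by rewrite mul0r cos0 -lerBlDl sub0r cos_geN1.
  - apply: continuous_subspaceT => u; apply: cvgD; exact: continuous_expR_cos.
  - by rewrite -[X in _ --> X](addr0 0); apply: cvgD;
    exact: cvgy_laplace_primitive.
  - by move=> x _; have [] := df x.
  - exact/cvg_at_right_filter/cG.
  - by move=> x _; rewrite derive1E; have [_ ->] := df x.
(* The part with y = 0 is already known; cancelling it on both sides leaves the oscillating part. *)
move: H; rewrite RintegralD//; [|exact: integrable_expR_cos..].
rewrite (_ : Rintegral _ _ _ = laplace_kernel a 0); first exact: addrI.
rewrite /Rintegral -[RHS]/(fine (laplace_kernel a 0)%:E) -integral_sqr_expR//;
  congr fine.
by apply: eq_integral => u _; rewrite mul0r cos0 mulr1.
Qed.

(** * Translation invariance of the integral *)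

Lemma ge0_integral_shift {R : realType} (G : R -> R) (c : R) : continuous G ->
  (forall x, 0 <= G x) ->
  (\int[mu]_x (G (x - c))%:E = \int[mu]_x (G x)%:E)%E.
Proof.
move=> cG G0.
have dF (x : R) : is_derive x 1 (fun x : R => x - c) 1.
  by apply: is_derive_eq; rewrite subr0.
have E : derive1 (fun x : R => x - c) = cst 1.
  by apply/funext => x; rewrite derive1E; have [_ ->] := dF x.
rewrite [RHS](@increasing_ge0_integration_by_substitutionT _ (fun x : R =>
  x - c))//.
- by rewrite E; apply: eq_integral => x _; rewrite /= mulr1.
- by move=> x y; rewrite ltrD2r.
- by rewrite E; exact: cst_continuous.
- by rewrite E; exact: is_cvg_cst.
- by rewrite E; exact: is_cvg_cst.
- by apply: cvg_addrr_Ny.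
- by apply: cvg_addrr.
Qed.

Lemma Rintegral_shift {R : realType} (G : R -> R) (c : R) : continuous G ->
  mu.-integrable setT (EFin \o G) ->
  mu.-integrable setT (EFin \o (fun x => G (x - c))) /\
  Rintegral mu setT (fun x => G (x - c)) = Rintegral mu setT G.
Proof.
move=> cG iG.
have cs : continuous (fun x : R => G (x - c)).
  move=> x; apply: continuous_comp; last exact: cG.
  by apply: cvgB; [exact: cvg_id|exact: cvg_cst].
have ca : continuous (fun x : R => `|G x|).
  by move=> x; apply: continuous_comp; [exact: cG|exact: norm_continuous].
have iS : mu.-integrable setT (EFin \o (fun x => G (x - c))).
  apply/integrableP; split.
    by apply/measurable_EFinP; exact: continuous_measurable_fun.
  have [_] := integrableP _ _ _ iG; rewrite /=.
  by rewrite -(ge0_integral_shift _ c ca).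
split=> //.
have ia : mu.-integrable setT (EFin \o (fun x => `|G x|)).
  exact: integrable_abse iG.
have ias : mu.-integrable setT (EFin \o (fun x => `|G (x - c)|)).
  exact: integrable_abse iS.
(* The substitution theorem needs a nonnegative integrand: use G + |G|. *)
have H : Rintegral mu setT (fun x => G (x - c) + `|G (x - c)|) =
         Rintegral mu setT (fun x => G x + `|G x|).
  rewrite /Rintegral (ge0_integral_shift (fun x => G x + `|G x|) c)//.
    by move=> x; apply: cvgD; [exact: cG|exact: ca].
  by move=> x; rewrite -lerBlDl sub0r ler_normr lexx orbT.
move: H; rewrite !RintegralD//.
rewrite (_ : Rintegral mu setT (fun x => `|G (x - c)|) =
  Rintegral mu setT (fun x => `|G x|)).
  exact: addIr.
by rewrite /Rintegral (ge0_integral_shift _ c ca).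
Qed.

(** * Integrability of Schwartz functions *)

Lemma schwartz_continuous {R : realType} (phi : R -> R) :
  schwartz phi -> continuous phi.
Proof.
by move=> [d _] x; apply/differentiable_continuous/derivable1_diffP;
  exact: (d 0).
Qed.

(** By evenness the integral is twice the arctangent integral over the half-line. The function
    serves as the majorant for Schwartz functions. *)
Lemma integrable_oneDsqrV {R : realType} :
  mu.-integrable setT (EFin \o (fun x : R => (1 + x ^+ 2)^-1)).
Proof.
have c : continuous (fun x : R => (1 + x ^+ 2)^-1) := @continuous_oneDsqrV R.
have p (x : R) : 0 <= (1 + x ^+ 2)^-1 by rewrite invr_ge0 addr_ge0 ?sqr_ge0.
apply/integrableP; split.
  by apply/measurable_EFinP; exact: continuous_measurable_fun.
have E (x : R) : `|(1 + x ^+ 2)^-1| = (1 + x ^+ 2)^-1 by rewrite ger0_norm.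
under eq_integral do rewrite /= E.
rewrite ge0_symfun_integralT//; last by move=> x; rewrite fctE sqrrN.
by rewrite -set_itvcy integral0y_oneDsqr -EFinM ltry.
Qed.

Lemma schwartz_integrable {R : realType} (phi : R -> R) : schwartz phi ->
  mu.-integrable setT (EFin \o phi).
Proof.
move=> sphi; have cphi := schwartz_continuous _ sphi; case: sphi => _ s.
(* The decay bounds of orders 0 and 2 add up to (1 + x^2) |phi x| <= M0 + M2. *)
have [M0 hM0] := s 0 0; have [M2 hM2] := s 2 0.
have := integrableZl measurableT (M0 + M2) integrable_oneDsqrV.
apply: le_integrable => //.
  by apply/measurable_EFinP; exact: continuous_measurable_fun.
move=> x _ /=; rewrite lee_fin.
have M0x := hM0 x; have M2x := hM2 x.
rewrite /derive1n /= expr0 mul1r in M0x; rewrite /derive1n/= real_normK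
  ?num_real// in M2x.
rewrite (le_trans _ (ler_norm _))// ler_pdivlMr; last by nra.
by rewrite mulrDr mulr1 [_ * x ^+ 2]mulrC lerD.
Qed.

(** * Real forms of the contributions and of the Fourier transform *)

Lemma zero_contributionE {R : realType} (phi : R -> R)
    (t0 sigma beta gamma : R) :
  sigma != beta ->
  zero_contribution phi t0 (beta +i* gamma) sigma =
  Rintegral mu setT (fun t => phi (t - t0) *
    laplace_kernel (sigma - beta) (t - gamma)).
Proof.
move=> sb; rewrite /zero_contribution /cintegral/=.
apply: eq_Rintegral => t _.
have a0 : (sigma - beta) != 0 by rewrite subr_eq0.
have : 0 < (sigma - beta) ^+ 2 + (t - gamma) ^+ 2.
  by rewrite ltr_pwDl ?sqr_ge0// lt_neqAle sqr_ge0 eq_sym sqrf_eq0 a0.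
rewrite /laplace_kernel; move: (sigma - beta) (t - gamma) => a y D.
(* This is |z^3|^2 = |z|^6 for z = a + iy: the squared terms are the real and imaginary parts of
   z^3. *)
have E : (a * (a * a - y * y) - y * (a * y + y * a)) ^+ 2 +
   (a * (a * y + y * a) + y * (a * a - y * y)) ^+ 2 =
     (a ^+ 2 + y ^+ 2) ^+ 3 by ring.
rewrite E; field.
by rewrite lt0r_neq0.
Qed.

(** Oddness carries the Laplace representation, established for a > 0, over to a zero to the right
    of the line of integration. *)
Lemma laplace_kernelN {R : realType} (a y : R) :
  laplace_kernel (- a) y = - laplace_kernel a y.
Proof. by rewrite /laplace_kernel sqrrN (_ : (- a) ^+ 3 = - a ^+ 3); ring. Qed.

Lemma Re_fourier {R : realType} (phi : R -> R) (u : R) :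
  complex.Re (fourier phi u) = Rintegral mu setT (fun t => phi t * cos (u * t)).
Proof.
rewrite /fourier /cintegral/=; apply: eq_Rintegral => t _ /=.
by rewrite expR0 cosN; ring.
Qed.

(** This identifies the sine integral that vanishes as soon as the Fourier transform is real. *)
Lemma Im_fourier {R : realType} (phi : R -> R) (u : R) :
  complex.Im (fourier phi u) = Rintegral mu setT (fun t =>
    phi t * - sin (u * t)).
Proof.
rewrite /fourier /cintegral/=; apply: eq_Rintegral => t _ /=.
by rewrite expR0 sinN; ring.
Qed.

(** * Exchange of the Laplace and Fourier integrals *)

Lemma integrableM_bounded {R : realType} (f g : R -> R) :
  mu.-integrable setT (EFin \o f) -> continuous g -> (forall x, `|g x| <= 1) ->
  mu.-integrable setT (EFin \o (fun x => f x * g x)).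
Proof.
move=> fi cg g1; have /measurable_int/measurable_EFinP mf := fi.
apply: le_integrable fi => //.
  by apply/measurable_EFinP/measurable_funM => //;
    exact: continuous_measurable_fun.
by move=> x _ /=; rewrite lee_fin normrM ler_piMr.
Qed.

Lemma continuous_cos_lin {R : realType} (y : R) :
  continuous (fun x : R => cos (y * x)).
Proof.
by move=> x; apply/differentiable_continuous/derivable1_diffP; apply: ex_derive.
Qed.

Lemma continuous_sin_lin {R : realType} (y : R) :
  continuous (fun x : R => sin (y * x)).
Proof.
by move=> x; apply/differentiable_continuous/derivable1_diffP; apply: ex_derive.
Qed.

Lemma continuous_cos_aff {R : realType} (y w : R) : continuous (fun x : R =>
  cos (y * (x - w))).
Proof.
by move=> x; apply/differentiable_continuous/derivable1_diffP; apply: ex_derive.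
Qed.

(** The kernel is replaced by its Laplace integral in u and the order of integration is exchanged.
    Fubini also supplies the integrability in t. *)
Lemma laplace_fubini {R : realType} (psi : R -> R) (a w : R) :
  mu.-integrable setT (EFin \o psi) -> 0 < a ->
  mu.-integrable setT (EFin \o (fun t => psi t * laplace_kernel a (t - w))) /\
  Rintegral mu setT (fun t => psi t * laplace_kernel a (t - w)) =
  Rintegral mu `[0%R : R, +oo[ (fun u => u ^+ 2 * expR (- (a * u)) *
    Rintegral mu setT (fun t => psi t * cos (u * (t - w)))).
Proof.
move=> ip a0.
have /measurable_int/measurable_EFinP mp := ip.
(* Extension by zero lets both variables range over the whole line. *)
pose k : R -> R := (fun u : R => u ^+ 2 * expR (- (a * u))) \_ `[0%R : R, +oo[.
have ik : mu.-integrable setT (EFin \o k).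
  rewrite /k -restrict_EFin -integrable_mkcond//; exact: integrable_sqr_expR.
have /measurable_int/measurable_EFinP mk := ik.
pose f (z : measurableTypeR R * measurableTypeR R) : \bar R :=
  (k z.2 * (psi z.1 * cos (z.2 * (z.1 - w))))%:E.
have mf : measurable_fun setT f.
  apply/measurable_EFinP; apply: measurable_funM.
    exact: measurableT_comp.
  apply: measurable_funM; first exact: measurableT_comp.
  apply: measurableT_comp; first by apply: continuous_measurable_fun;
    exact: continuous_cos.
  by apply: measurable_funM => //; apply: measurable_funB.
have ic u : mu.-integrable setT (EFin \o (fun t => psi t * cos (u * (t - w)))).
  apply: integrableM_bounded => //; first exact: continuous_cos_aff.
  by move=> t; exact: cos_max.
have mpa : measurable_fun setT (fun t => `|(psi t)%:E|)%E.
  by apply: measurableT_comp => //; exact/measurable_EFinP.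
have mka : measurable_fun setT (fun u => `|(k u)%:E|)%E.
  by apply: measurableT_comp => //; exact/measurable_EFinP.
have mI : measurable_fun setT (fun u => \int[mu]_t `|f (t, u)|)%E.
  apply: (measurable_fun_fubini_tonelli_G (abse \o f)).
    exact: measurableT_comp.
  by move=> z; exact: abse_ge0.
have mfu u : measurable_fun setT (fun t => f (t, u)).
  have /measurable_int := integrableZl measurableT (k u) (ic u).
  by rewrite /f.
(* Since |f (t, u)| <= |k u| |psi t|, the iterated integral of |f| is at most the product of the L^1
   norms of [k] and [psi]. *)
have If : (mu \x mu)%E.-integrable setT f.
  apply/(integrable21ltyP _ _ mf).
  pose N := (\int[mu]_t `|(psi t)%:E|)%E.
  have N0 : (N < +oo)%E by have [_] := integrableP _ _ _ ip.
  have N_ge0 : (0 <= N)%E by exact: integral_ge0.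
  apply: (@le_lt_trans _ _ (\int[mu]_u (`|(k u)%:E| * N))%E).
    apply: ge0_le_integral => //.
    - by move=> u _; exact: integral_ge0.
    - exact: emeasurable_funM.
    - move=> u _; rewrite /f /N -ge0_integralZl//.
      apply: ge0_le_integral => //.
      + by apply: measurableT_comp => //; exact: mfu.
      + exact: emeasurable_funM.
      + move=> t _ /=; rewrite -EFinM lee_fin !normrM ler_wpM2l// ler_piMr//.
        exact: cos_max.
  rewrite ge0_integralZr//.
  have [_ kk] := integrableP _ _ _ ik.
  by rewrite lte_mul_pinfty// ?integral_ge0// ge0_fin_numE// integral_ge0.
(* Integration in u gives back the kernel, with frequency y = t - w. *)
have inner t : (\int[mu]_u f (t, u) = (psi t * laplace_kernel a (t - w))%:E)%E.
  have -> : psi t * laplace_kernel a (t - w) = \int[mu]_(u in `[0%R : R,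
    +oo[) (psi t * (u ^+ 2 * expR (- (a * u)) * cos ((t - w) * u))).
    by rewrite RintegralZl//; [rewrite Rintegral_expR_cos|exact:
      integrable_expR_cos].
  rewrite Rintegral_mkcond /Rintegral fineK.
    apply: eq_integral => u _; rewrite /f /k /patch; case: ifP => _ /=.
      by rewrite [u * _]mulrC; congr EFin; ring.
    by rewrite mul0r.
  have H : mu.-integrable setT (EFin \o
      ((fun u => psi t * (u ^+ 2 * expR (- (a * u)) * cos ((t - w) *
        u))) \_ `[0%R : R, +oo[)).
    rewrite -restrict_EFin -integrable_mkcond//.
    exact: (integrableZl _ _ (integrable_expR_cos _ _ a0)).
  exact: (integrable_fin_num _ H).
split.
  apply: eq_integrable (integrable_fubini_F If) => // t _.
  exact: inner.
rewrite [RHS]Rintegral_mkcond /Rintegral.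
transitivity (fine (\int[mu]_t \int[mu]_u f (t, u))).
  by congr fine; apply: eq_integral => t _; rewrite inner.
rewrite (Fubini If); congr fine; apply: eq_integral => u _.
rewrite -/(Rintegral _ _ _).
transitivity ((k u * Rintegral mu setT (fun t =>
  psi t * cos (u * (t - w))))%:E); last first.
  by rewrite /k /patch; case: ifP => _ //; rewrite mul0r.
rewrite -RintegralZl// /Rintegral fineK//.
by apply: integrable_fin_num => //; exact: (integrableZl measurableT (k u) (ic
  u)).
Qed.

(** * Contributions as Laplace integrals of the Fourier transform *)

Definition cos_transform {R : realType} (phi : R -> R) (u : R) : R :=
  Rintegral mu setT (fun t => phi t * cos (u * t)).

Section contribution.
Context {R : realType} (phi : R -> R).
Context (cphi : continuous phi) (iphi : mu.-integrable setT (EFin \o phi)).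
Context (sine_part0 :
  forall u, Rintegral mu setT (fun t => phi t * - sin (u * t)) = 0).

Let F := cos_transform phi.

Lemma integrable_mul_cos u : mu.-integrable setT (EFin \o (fun t =>
  phi t * cos (u * t))).
Proof.
apply: integrableM_bounded => //; first exact: continuous_cos_lin.
by move=> x; exact: cos_max.
Qed.

Lemma integrable_mul_sin u : mu.-integrable setT (EFin \o (fun t =>
  phi t * sin (u * t))).
Proof.
apply: integrableM_bounded => //; first exact: continuous_sin_lin.
by move=> x; exact: sin_max.
Qed.

Lemma cos_transform_le u : `|F u| <= Rintegral mu setT (fun t => `|phi t|).
Proof.
apply: le_trans (le_normr_Rintegral _ (integrable_mul_cos u)) _ => //.
apply: le_Rintegral => //.
- exact: integrable_abse (integrable_mul_cos u).
- exact: integrable_abse iphi.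
- by move=> t _; rewrite normrM ler_piMr// cos_max.
Qed.

Lemma cos_transformN u : F (- u) = F u.
Proof. by apply: eq_Rintegral => t _; rewrite mulNr cosN. Qed.

(** Continuity under the integral sign, with majorant |phi| near x. It is what makes [F]
    measurable. *)
Lemma continuous_cos_transform : continuous F.
Proof.
move=> x.
apply: (@continuity_under_integral _ _ _ mu (fun u t =>
  phi t * cos (u * t)) setT measurableT
   (x - 1) (x + 1) _ _ (fun t => `|phi t|)) => //.
- by move=> u _; exact: integrable_mul_cos.
- apply: aeW => t _ u _; apply: cvgM; first exact: cvg_cst.
  under eq_fun do rewrite mulrC.
  rewrite mulrC; exact: continuous_cos_lin.
- exact: integrable_abse iphi.
- by move=> u _; apply: aeW => t _; rewrite normrM ler_piMr// cos_max.
- by rewrite inE/= in_itv/=; apply/andP; split; lra.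
Qed.

Lemma measurable_cos_transform : measurable_fun setT F.
Proof. by apply: continuous_measurable_fun;
  exact: continuous_cos_transform. Qed.

(** After the translation s = t - t0, the addition formula splits the cosine into a cosine part,
    which gives [F u], and a sine part, which vanishes by [sine_part0]. *)
Lemma Rintegral_shifted_cos t0 w u :
  Rintegral mu setT (fun t => phi (t - t0) * cos (u * (t - w))) =
    cos ((w - t0) * u) * F u.
Proof.
pose G s := phi s * cos (u * (s - (w - t0))).
have cG : continuous G.
  by move=> s; apply: cvgM; [exact: cphi|exact: continuous_cos_aff].
have iG : mu.-integrable setT (EFin \o G).
  apply: integrableM_bounded => //; first exact: continuous_cos_aff.
  by move=> x; exact: cos_max.
have [_] := Rintegral_shift _ t0 cG iG.
rewrite (_ : (fun x => G (x - t0)) = (fun t =>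
  phi (t - t0) * cos (u * (t - w)))); last first.
  by apply/funext => t; rewrite /G; congr (_ * cos (_ * _)); ring.
move=> ->.
transitivity (Rintegral mu setT (fun s =>
  cos ((w - t0) * u) * (phi s * cos (u * s))
   + sin ((w - t0) * u) * (phi s * sin (u * s)))).
  apply: eq_Rintegral => s _.
  by rewrite /G mulrBr cosB [(w - t0) * u]mulrC; ring.
have ii := integrable_mul_cos u; have jj := integrable_mul_sin u.
rewrite RintegralD//; [|exact: (integrableZl measurableT _ ii)|exact:
  (integrableZl measurableT _ jj)].
rewrite !RintegralZl//.
rewrite [X in _ + _ * X](_ : _ = 0) ?mulr0 ?addr0//.
apply: oppr_inj; rewrite oppr0 -mulN1r -RintegralZl// -[RHS](sine_part0 u).
by apply: eq_Rintegral => s _; ring.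
Qed.

(** [F] is bounded by the L^1 norm of [phi], so a multiple of u^2 e^(-au) is a majorant. *)
Lemma integrable_laplace_cos_transform a w : 0 < a ->
  mu.-integrable `[0%R : R, +oo[
    (EFin \o (fun u => u ^+ 2 * expR (- (a * u)) * (cos (w * u) * F u))).
Proof.
move=> a0.
have mI : measurable (`[0%R : R, +oo[%classic :
  set (measurableTypeR R)) by exact: measurable_itv.
have := integrableZl mI (Rintegral mu setT (fun t =>
  `|phi t|)) (integrable_sqr_expR a a0).
apply: le_integrable => //.
  apply/measurable_EFinP; apply: measurable_funTS.
  rewrite (_ : (fun _ => _) = (fun u => (u ^+ 2 * expR (- (a * u)) * cos (w *
    u)) * F u)); last first.
    by apply/funext => u; rewrite mulrA.
  apply: measurable_funM; last exact: measurable_cos_transform.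
  by apply: continuous_measurable_fun; exact: continuous_expR_cos.
move=> u _ /=; rewrite lee_fin normrM [X in _ <= X]normrM mulrC ler_wpM2r//.
rewrite normrM (le_trans _ (ler_norm _))// (le_trans _ (cos_transform_le u))//.
by rewrite ler_piMl// cos_max.
Qed.

Lemma integrable_laplace_kernel a t0 gamma : 0 < a ->
  mu.-integrable setT (EFin \o (fun t => phi (t - t0) *
    laplace_kernel a (t - gamma))).
Proof.
move=> a0; have [iS _] := Rintegral_shift _ t0 cphi iphi.
by have [] := laplace_fubini _ _ gamma iS a0.
Qed.

Lemma Rintegral_laplace_kernel a t0 gamma : 0 < a ->
  Rintegral mu setT (fun t => phi (t - t0) * laplace_kernel a (t - gamma)) =
  Rintegral mu `[0%R : R, +oo[ (fun u => u ^+ 2 * expR (- (a * u)) *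
    (cos ((gamma - t0) * u) * F u)).
Proof.
move=> a0; have [iS _] := Rintegral_shift _ t0 cphi iphi.
have [_ ->] := laplace_fubini _ _ gamma iS a0.
by apply: eq_Rintegral => u _; rewrite Rintegral_shifted_cos.
Qed.

End contribution.

(** * Strict positivity of integrals *)

Lemma Rintegral_gt0 d (T : measurableType d) (R : realType)
    (nu : {measure set T -> \bar R}) (D N : set T) (f : T -> R) :
  measurable D -> measurable N -> N `<=` D -> nu.-integrable D (EFin \o f) ->
  (forall x, D x -> 0 <= f x) -> (0 < nu N)%E -> (forall x, N x -> 0 < f x) ->
  0 < Rintegral nu D f.
Proof.
move=> mD mN ND fi f0 N0 fN; rewrite lt_neqAle Rintegral_ge0// andbT.
(* If the integral were zero, f would vanish almost everywhere on D, and N, where f > 0, would lie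
   in a null set. *)
apply/negP => /eqP If0; move: N0; rewrite ltNge => /negP; apply.
have int0 : (\int[nu]_(x in D) `|(f x)%:E| = 0)%E.
  under eq_integral => x /[!inE] Dx do rewrite gee0_abs ?lee_fin ?f0//.
  by rewrite -[LHS]fineK ?(integrable_fin_num _ fi)// -[fine _]If0.
have [Z [mZ Z0 sZ]] := (ae_eq_integral_abs _ mD (measurable_int _ fi)).1 int0.
rewrite -Z0; apply: le_measure; rewrite ?inE//.
move=> x Nx; apply: sZ => /= H; have := fN x Nx.
by have [->] := H (ND x Nx); rewrite ltxx.
Qed.

(** By evenness, A is covered by the positivity set on u > 0, its reflection and the point 0; were
    the first null, A would be null. This moves positivity anywhere on the line to the half-line of
    the Laplace integrals. *)
Lemma even_pos_halfline (R : realType) (F : R -> R) (A : set R) :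
  measurable_fun setT F -> (forall u, F (- u) = F u) ->
  measurable A -> (0 < mu A)%E -> (forall u, A u -> 0 < F u) ->
  measurable [set u : R | (0 < u)%R && (0 < F u)%R] /\
  (0 < mu [set u : R | (0 < u)%R && (0 < F u)%R])%E.
Proof.
move=> mF Fev mA A0 AF; set N := [set u | _].
have mN : measurable N.
  rewrite (_ : N = `]0, +oo[ `&` F @^-1` `]0, +oo[).
    by apply: measurableI => //; rewrite -[X in measurable X]setTI; apply: mF.
  by apply/seteqP; split => u /=; rewrite !in_itv/= !andbT => /andP.
have mNN : measurable ((-%R : R -> R) @^-1` N).
  by rewrite -[X in measurable X]setTI; exact: (@oppr_measurable R setT).
split=> //; rewrite lt0e measure_ge0 andbT; apply: contraTN A0 => /eqP N0.
rewrite -leNgt.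
have sub : A `<=` N `|` ((-%R : R -> R) @^-1` N) `|` [set 0].
  move=> u Au; have Fu := AF u Au; case: (ltgtP u 0) => u0.
  - by left; right; rewrite /N/= oppr_gt0 u0 Fev Fu.
  - by left; left; rewrite /N/= u0 Fu.
  - by right.
apply: le_trans (le_measure mu _ _ sub) _; rewrite ?inE//.
  by apply: measurableU => //; apply: measurableU.
have NN0 : mu ((-%R : R -> R) @^-1` N) = 0%E by rewrite -N0
  -[RHS]lebesgue_measureN.
apply: le_trans (measureU2 _ _ _) _ => //; first exact: measurableU.
rewrite [X in (_ + X)%E](_ : _ = 0%E) ?adde0; last exact: lebesgue_measure_set1.
apply: le_trans (measureU2 _ _ _) _ => //.
rewrite [X in (X + _)%E](_ : _ = 0%E) ?add0e; last exact: N0.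
by rewrite [X in (X <= _)%E](_ : _ = 0%E)//; exact: NN0.
Qed.

End laplace_representation.

(** * Comparison of the paired contribution with the bound *)

Theorem proposition5p5 (R : realType) (Xi : R[i] -> R[i])
  (hXi : is_completed_zeta Xi)
  (phi : R -> R) (hphi : schwartz phi) (hphi_even : forall t, phi (- t) = phi t)
  (t0 delta0 : R) (hdelta0 : 0 < delta0)
  (beta gamma Y : R) (hY : 0 < Y)
  (hrho : zeros_upto Xi Y (beta +i* gamma))
  (hbeta : 1 / 2 + delta0 < beta)
  (hfourier : forall u : R, 0 <= fourier phi u)
  (c0 : R) (hc0 : 0 < c0)
  (hcos : forall u : R, supp (fourier phi) u -> 0 <= u ->
     c0 <= cos ((gamma - t0) * u)) :
  let rho := beta +i* gamma in
  let paired := zero_contribution phi t0 rho (1 / 2 - delta0)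
              + zero_contribution phi t0 (1 - rho^*) (1 / 2 - delta0) in
  let bound := 2 * c0 * Rintegral lebesgue_measure `[0, +oo[
                 (fun u => u ^+ 2 * expR (- (beta - 1 / 2) * u) * sinh (delta0 * u)
                           * complex.Re (fourier phi u)) in
  [/\ bound <= paired,
      0 <= bound &
      (exists A : set R, [/\ measurable A,
          (0 < @lebesgue_measure R A)%E &
          forall u : R, A u -> 0 < fourier phi u]) ->
      0 < paired].
Proof.
move=> rho paired bound.
have cphi := schwartz_continuous _ hphi.
have iphi := schwartz_integrable _ hphi.
have FE u : complex.Re (fourier phi u) = cos_transform phi u :=
  Re_fourier phi u.
(* Nonnegativity in the order of R[i] includes being real. *)
have sine_part0 u : Rintegral lebesgue_measure setT (fun t =>
  phi t * - sin (u * t)) = 0.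
  by rewrite -Im_fourier; have := hfourier u; rewrite lecE => /andP[/eqP].
have F0 u : 0 <= cos_transform phi u.
  by rewrite -FE; have := hfourier u; rewrite lecE => /andP[].
pose F := cos_transform phi.
(* With sigma = 1/2 - delta0, these are a = sigma - (1 - beta) and b = beta - sigma, the distances
   of the line to the two zeros; [hbeta] says that a > 0. *)
pose a := beta - 1 / 2 - delta0; pose b := beta - 1 / 2 + delta0.
have a0 : 0 < a by rewrite /a; lra.
have b0 : 0 < b by rewrite /b; lra.
have ab : a < b by rewrite /a /b; lra.
(* The frequency w = gamma - t0 gives the contributions; w = 0, where the cosine is 1, gives the
   bound. *)
pose h c w u := u ^+ 2 * expR (- (c * u)) * (cos (w * u) * F u).
have ih c w (c_gt0 : 0 < c) : lebesgue_measure.-integrable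
    `[0%R : R, +oo[ (EFin \o h c w).
  exact: integrable_laplace_cos_transform.
have pairedE : paired = Rintegral lebesgue_measure `[0, +oo[ (fun u =>
  h a (gamma - t0) u - h b (gamma - t0) u).
  rewrite RintegralB//; [|exact: ih..].
  rewrite /paired zero_contributionE; last by apply/eqP; lra.
  rewrite (_ : 1 - rho^* = (1 - beta) +i* gamma); last first.
    by apply/eqP; rewrite eq_complex /=; apply/andP; split; apply/eqP; ring.
  rewrite zero_contributionE; last by apply/eqP; lra.
  rewrite (_ : 1 / 2 - delta0 - beta = - b); last by rewrite /b; ring.
  rewrite (_ : 1 / 2 - delta0 - (1 - beta) = a); last by rewrite /a; field.
  rewrite /h -!Rintegral_laplace_kernel// addrC; congr (_ + _).
  rewrite -[RHS]mulN1r -RintegralZl//.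
    by apply: eq_Rintegral => t _; rewrite laplace_kernelN; ring.
  exact: integrable_laplace_kernel.
have idiff w : lebesgue_measure.-integrable `[0%R : R, +oo[ (EFin \o (fun u =>
  h a w u - h b w u)).
  exact: (integrableB _ (ih a w a0) (ih b w b0)).
(* The exponents satisfy -au = -(beta - 1/2)u + delta0 u and -bu = -(beta - 1/2)u - delta0 u; the
   denominator of sinh absorbs the factor 2. *)
have boundE : bound = c0 * Rintegral lebesgue_measure `[0, +oo[ (fun u =>
  h a 0 u - h b 0 u).
  rewrite /bound -mulrA mulrCA; congr (_ * _).
  transitivity (2 * Rintegral lebesgue_measure `[0, +oo[ (fun u =>
    2^-1 * (h a 0 u - h b 0 u))).
    congr (_ * _); apply: eq_Rintegral => u _.
    rewrite /h FE mul0r cos0 !mul1r /sinh -/F.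
    rewrite (_ : - (a * u) = - (beta - 2^-1) * u + delta0 * u);
      last by rewrite /a; field.
    rewrite (_ : - (b * u) = - (beta - 2^-1) * u - delta0 * u);
      last by rewrite /b; field.
    by rewrite !expRD; field.
  by rewrite RintegralZl ?mulVKf ?pnatr_eq0.
have weight_ge0 u : 0 <= u -> 0 <= expR (- (a * u)) - expR (- (b * u)).
  by move=> u0; rewrite subr_ge0 ler_expR lerN2 ler_wpM2r// ltW.
have h0_ge0 u : 0 <= u -> 0 <= h a 0 u - h b 0 u.
  move=> u0; rewrite /h -mulrBl -mulrBr mul0r cos0 mul1r.
  by rewrite !mulr_ge0 ?sqr_ge0 ?weight_ge0 ?F0.
have I_ge0 : 0 <= Rintegral lebesgue_measure `[0, +oo[ (fun u =>
  h a 0 u - h b 0 u).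
  apply: Rintegral_ge0 => u /=; rewrite in_itv/= andbT; exact: h0_ge0.
have le_paired : bound <= paired.
  rewrite boundE pairedE -RintegralZl//; apply: le_Rintegral => //.
    exact: (integrableZl _ _ (idiff 0)).
  move=> u /=; rewrite in_itv/= andbT => u0.
  rewrite /h -!mulrBl -!mulrBr mul0r cos0 mul1r mulrCA.
  rewrite ler_wpM2l//; first by rewrite mulr_ge0 ?sqr_ge0 ?weight_ge0.
  (* Where [F u] = 0 both integrands vanish; elsewhere u lies in the support and the cosine is at
     least c0. *)
  have [Fu0|Fu0] := eqVneq (F u) 0; first by rewrite Fu0 !mulr0.
  rewrite ler_wpM2r ?F0// hcos//; apply: subset_closure => /=.
  by apply: contraNneq Fu0 => fu; rewrite /F -FE fu.
split=> //; first by rewrite boundE mulr_ge0// ltW.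
(* It suffices that the bound be positive: its integrand is positive wherever u > 0 and [F u] > 0,
   because a < b. *)
move=> [A [mA A0 Apos]]; apply: lt_le_trans le_paired.
rewrite boundE mulr_gt0//.
have mF : measurable_fun setT F by exact: measurable_cos_transform.
have AF u : A u -> 0 < F u.
  by move=> /Apos; rewrite ltcE FE => /andP[].
have [mN N0] := even_pos_halfline _ _ _ mF (cos_transformN phi) mA A0 AF.
apply: (@Rintegral_gt0 _ (measurableTypeR R) R (@lebesgue_measure R) _ _ _ _ mN
  _ (idiff 0) _ N0) => //.
- by move=> u /= /andP[u0 _]; rewrite in_itv/= andbT ltW.
- by move=> u /=; rewrite in_itv/= andbT; exact: h0_ge0.
- move=> u /= /andP[u0 Fu].
  rewrite /h -mulrBl -mulrBr mul0r cos0 mul1r !mulr_gt0//.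
  by rewrite subr_gt0 ltr_expR ltrN2 ltr_pM2r.
Qed.
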